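(* For any primitive set $A\subset\mathbb{Z}_{>1}$ and any prime $p>2$, we have $f(A_p)\le f(p)=\frac{1}{p\log p}$, where $A_p=\{n\in A: \text{the least prime factor of } n \text{ is } p\}$.
   Context: A set $A\subset\mathbb{Z}_{>1}$ is primitive if no member of $A$ divides another member of $A$. For $A\subset\mathbb{Z}_{>1}$, $f(A)=\sum_{a\in A}\frac{1}{a\log a}$, and $f(p)=f(\{p\})$. *)

(* Defs.v *)
From HB Require Import structures.
From mathcomp Require Import all_boot all_order all_algebra.
From mathcomp Require Import all_classical all_reals all_analysis.
Set Implicit Arguments. Unset Strict Implicit. Unset Printing Implicit Defensive.
Import Order.TTheory GRing.Theory Num.Theory.
Local Open Scope classical_set_scope.
Local Open Scope ring_scope.

Definition subset_gt1 (A : set nat) : Prop := forall a, A a -> (1 < a)%N.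

Definition primitive (A : set nat) : Prop :=
  forall a b, A a -> A b -> a != b -> ~~ (a %| b)%N.

Definition f (R : realType) (A : set nat) : \bar R :=
  (\esum_(a in A) ((a%:R * ln (a%:R : R))^-1)%:E)%E.

Definition A_p (A : set nat) (p : nat) : set nat := [set n | A n /\ pdiv n = p].

(* Main.v *)
(** Let [n] range over the multiples [p k] of [p] with [k] free of primes below
    [p].  Since [ln k] is the sum of [mangoldt q] over [q %| k], the weights
    [mangoldt q / ln k] define a random walk [k -> k / q] down to [1].  If
    [F k = g k / k], with [g 1 = 1 / ln p] and [g k >= 1 / (ln k + ln p)], is
    superharmonic for this walk, then a flow argument bounds the sum of [F] over
    a primitive set by [F 1], which is the claim up to a factor [1 / p].

    We take [g k = 1 / (ln k + 2 c)] for [k > 1].  By partial summation,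
    superharmonicity follows from
      [\sum_(q <= n, q free of primes below p) mangoldt q / q <= ln n - c],
    an explicit Mertens estimate derived from [n`!] and the Chebyshev bound
    [psi n <= (n - 1) ln 4].  One can take [c = ln p / 2] when [p >= 5]: the loss
    in the estimate is at most [ln 4], which is below [ln p / 2] as soon as
    [p > 16], and the primes 5, 7, 11, 13 are handled by removing explicit prime
    powers.  For [p = 3] only [c = 0.29] is available, and superharmonicity
    at [k = 1] is checked numerically. *)
Require Import Defs.
From HB Require Import structures.
From mathcomp Require Import all_boot all_order all_algebra.
From mathcomp Require Import all_classical all_reals all_analysis.
From mathcomp Require Import zify ring lra.
Set Implicit Arguments. Unset Strict Implicit. Unset Printing Implicit Defensive.
Import Order.TTheory GRing.Theory Num.Theory.
Local Open Scope classical_set_scope.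
Local Open Scope ring_scope.

(** * The von Mangoldt function and Legendre's formula for factorials *)

Definition mangoldt {R : realType} (n : nat) : R :=
  if primes n is [:: r] then ln r%:R else 0.

Lemma lnn_ge0 {R : realType} (n : nat) : 0 <= ln (n%:R : R).
Proof. by case: n => [|n]; [rewrite ln0 | apply: ln_ge0; rewrite ler1n]. Qed.

Lemma mangoldt_ge0 {R : realType} (n : nat) : 0 <= mangoldt n :> R.
Proof. by rewrite /mangoldt; case: (primes n) => [|r [|]] //; apply: lnn_ge0. Qed.

Lemma primes1_pfactor (d r : nat) : primes d = [:: r] ->
  [/\ prime r, (0 < logn r d)%N & d = (r ^ logn r d)%N].
Proof.
move=> dr; have: r \in primes d by rewrite dr mem_head.
rewrite mem_primes => /and3P[r_pr d0 rd]; split=> //.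
  by rewrite logn_gt0 mem_primes r_pr d0.
by rewrite {1}(prod_prime_decomp d0) prime_decompE dr big_map big_seq1.
Qed.

Lemma mangoldt_pfactor {R : realType} (r e : nat) : prime r -> (0 < e)%N ->
  mangoldt (r ^ e) = ln r%:R :> R.
Proof. by move=> r_pr e0; rewrite /mangoldt primesX // primes_prime. Qed.

(** Multiplying [m] by a prime [r] creates exactly one new prime power divisor, the next power of
    [r]. *)
Lemma mangoldt_dvd_mul {R : realType} (r m d : nat) : prime r -> (0 < m)%N ->
  (if (d %| r * m)%N then mangoldt d else 0) =
  (if (d %| m)%N then mangoldt d else 0) +
  (if d == (r ^ (logn r m).+1)%N then ln r%:R else 0) :> R.
Proof.
move=> r_pr m0; have rm0 : (0 < r * m)%N by rewrite muln_gt0 prime_gt0.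
have pr1 : mangoldt (r ^ (logn r m).+1) = ln r%:R :> R by exact: mangoldt_pfactor.
have lr s : prime s -> logn s (r * m) = ((s == r) + logn s m)%N.
  by move=> s_pr; rewrite (lognM s (prime_gt0 r_pr) m0) (logn_prime _ r_pr).
case: eqVneq => [->|dr].
  by rewrite !pfactor_dvdn // lr // eqxx leqnn ltnn pr1 add0r.
rewrite addr0 /mangoldt; case dE: (primes d) => [|s [|? ?]]; rewrite ?if_same //.
have [s_pr e0 ds] := primes1_pfactor dE.
rewrite ds !pfactor_dvdn // lr //; case: eqVneq => [sr|//].
rewrite add1n leq_eqVlt ltnS; case: eqVneq => // ee.
by move: dr; rewrite ds ee sr eqxx.
Qed.

(** Induction stripping the least prime factor. The free range bound [N] lets sums for different [n]
    be added termwise. *)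
Lemma sum_mangoldt_dvd {R : realType} (N n : nat) : (0 < n <= N)%N ->
  \sum_(1 <= d < N.+1 | (d %| n)%N) mangoldt d = ln n%:R :> R.
Proof.
elim/ltn_ind: n => n IHn /andP[n0 nN].
have [n1|n1] := leqP n 1.
  have -> : n = 1%N by lia.
  rewrite ln1 big1 // => d; rewrite dvdn1 => /eqP ->.
  by rewrite /mangoldt.
have r_pr := pdiv_prime n1; set r := pdiv n in r_pr.
have nE : n = (r * (n %/ r))%N by rewrite mulnC divnK // pdiv_dvd.
set m := (n %/ r)%N in nE; have m0 : (0 < m)%N by move: n0; rewrite nE muln_gt0 => /andP[].
have mn : (m < n)%N by rewrite nE -{1}(mul1n m) ltn_mul2r m0 prime_gt1.
rewrite big_mkcond /= nE; under eq_bigr do rewrite mangoldt_dvd_mul //.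
rewrite big_split /= -big_mkcond /= IHn //; last by rewrite m0; lia.
rewrite -big_mkcond /= big_nat1_eq ltnS expn_gt0 prime_gt0 //=.
have -> : (r ^ (logn r m).+1 <= N)%N.
  apply: leq_trans nN; rewrite nE expnS leq_mul2l dvdn_leq ?orbT //.
  exact: pfactor_dvdnn.
by rewrite addrC natrM lnM // posrE ltr0n // prime_gt0.
Qed.

Lemma sum_mangoldt_divn {R : realType} (N n : nat) : (n <= N)%N ->
  \sum_(1 <= d < N.+1) mangoldt d * (n %/ d)%:R = ln n`!%:R :> R.
Proof.
elim: n => [_|n IHn nN].
  by rewrite fact0 ln1 big1 // => d _; rewrite div0n mulr0.
rewrite factS natrM lnM ?posrE ?ltr0n ?fact_gt0 // -IHn ?(ltnW nN) //.
rewrite -(@sum_mangoldt_dvd R N n.+1) // [X in X + _]big_mkcond -big_split /=.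
apply: eq_big_nat => d /andP[d0 _].
(* From [n] to [n.+1], the quotient by [d] grows by one exactly when [d] divides [n.+1]. *)
by rewrite divnS // natrD mulrDr; case: ifP; rewrite ?mulr1 ?mulr0.
Qed.

(** * Chebyshev's function and central binomial coefficients *)

Definition chebyshev_psi {R : realType} (n : nat) : R :=
  \sum_(1 <= d < n.+1) mangoldt d.

Lemma chebyshev_psiS {R : realType} (n : nat) :
  chebyshev_psi n.+1 = chebyshev_psi n + mangoldt n.+1 :> R.
Proof. by rewrite /chebyshev_psi big_nat_recr. Qed.

Lemma chebyshev_psi_bin {R : realType} (a b : nat) : (a <= b)%N ->
  chebyshev_psi (a + b) <= chebyshev_psi b + ln ('C(a + b, a))%:R :> R.
Proof.
move=> ab; have f0 n : (0 : R) < n`!%:R by rewrite ltr0n fact_gt0.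
have binE : ln ('C(a + b, a))%:R = ln (a + b)`!%:R - ln a`!%:R - ln b`!%:R :> R.
  have := bin_fact (leq_addr b a); rewrite addKn => <-.
  have C0 : (0 : R) < ('C(a + b, a))%:R by rewrite ltr0n bin_gt0 leq_addr.
  rewrite !natrM lnM ?posrE ?mulr_gt0 // lnM ?posrE //; lra.
rewrite binE -!(@sum_mangoldt_divn R (a + b)) ?leq_addl ?leq_addr //.
rewrite /chebyshev_psi (@big_nat_widen _ _ _ _ b.+1 (a + b).+1) ?ltnS ?leq_addl //.
rewrite [X in X + _]big_mkcond /= -!sumrB -big_split /=.
rewrite big_nat [leRHS]big_nat; apply: ler_sum => d /andP[d0 dab].
rewrite -!mulrBr; have := mangoldt_ge0 (R := R) d; rewrite ltnS.
(* By Legendre's formula [d] enters [ln 'C(a + b, a)] with a nonnegative coefficient. For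
   [b < d <= a + b] it is at least 1, because [a <= b < d] kills the other two quotients. *)
have : ((1 + a %/ d + b %/ d)%N <= (d <= b)%N + (a + b) %/ d)%N.
  have [db|bd] := leqP d b.
    by rewrite add1n addSn ltnS divnD // leq_addr.
  rewrite divn_small ?(leq_ltn_trans ab) // divn_small // add0n.
  by rewrite divn_gt0 //; lia.
rewrite -(ler_nat R) !natrD; case: (d <= b)%N => /=; nra.
Qed.

Lemma bin_le_exp2 (n k : nat) : ('C(n.+1, k) <= 2 ^ n)%N.
Proof.
elim: n k => [|n IHn] [|k]; rewrite ?bin0 ?expn_gt0 //.
  by case: k => [|k] //; rewrite bin_small.
by rewrite binS expnS mul2n -addnn leq_add.
Qed.

(** With [a = n./2], [ln 'C(n, a)] is at most [(n - 1) ln 2 <= a ln 4], which is what the bound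
    gains from [n - a] to [n]; the slack [c] survives. The exponent [n] in [bin_le_exp2], rather
    than [n.+1], is what makes odd [n] work. *)
Lemma chebyshev_psi_half {R : realType} (c : R) (n : nat) : (0 < n)%N ->
  chebyshev_psi (n - n./2) <= (n - n./2)%:R * ln 4 - c ->
  chebyshev_psi n <= n%:R * ln 4 - c :> R.
Proof.
move=> n0; set a := n./2; set b := (n - a)%N => psib.
have nE : n = (a + b)%N by rewrite /b subnKC // /a; lia.
have ab : (a <= b)%N by rewrite /b /a; lia.
have := @chebyshev_psi_bin R a b ab; rewrite -nE => psin.
have ln2 : 0 < ln 2 :> R by rewrite ln_gt0 // ltr1n.
have ln4 : ln 4 = 2 * ln 2 :> R.
  by rewrite (_ : 4 = 2 * 2) ?lnM ?posrE //; lra.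
have : ln ('C(n, a))%:R <= (n.-1)%:R * ln 2 :> R.
  rewrite mulr_natl -lnXn // ler_ln ?posrE ?exprn_gt0 //.
    by rewrite -natrX ler_nat -{1}(prednK n0) bin_le_exp2.
  by rewrite ltr0n bin_gt0 nE leq_addr.
have : (n.-1)%:R <= a%:R + a%:R :> R by rewrite -natrD ler_nat /a; lia.
have : n%:R = a%:R + b%:R :> R by rewrite -natrD -nE.
move=> -> n1 lnC; apply: le_trans psin _; rewrite ln4 in psib *.
have : (n.-1)%:R * ln 2 <= (a%:R + a%:R) * ln 2 :> R by rewrite ler_pM2r.
lra.
Qed.

(** * Logarithm inequalities and numerical values *)

Lemma ge0_derive_le {R : realType} (h h' : R -> R) (a b : R) : a <= b ->
  (forall x, a <= x -> is_derive x 1 h (h' x)) ->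
  (forall x, a <= x -> 0 <= h' x) -> h a <= h b.
Proof.
move=> ab dh h'0.
have dvh (x : R) : x \in `[a, b] -> derivable h x 1.
  by rewrite in_itv /= => /andP[ax _]; have [] := dh _ ax.
apply: (@ger0_derive1_ndecr R h a b) => //.
- by move=> x xz; apply/dvh/subset_itv_oo_cc.
- move=> x; rewrite in_itv /= => /andP[/ltW ax _].
  by have /@derive_val dx := dh x ax; rewrite derive1E dx h'0.
- exact: derivable_within_continuous.
Qed.

(* Both bounds are accurate to third order in [z - 1]. *)
Lemma ln_le_half {R : realType} (z : R) : 1 <= z -> ln z <= (z - z^-1) / 2.
Proof.
move=> z1; pose h : R -> R := 2^-1 \*: ((id : R -> R) - (fun x => x^-1)) - ln (R := R).
have dh (x : R) : 1 <= x -> is_derive x 1 h (2^-1 * (1 + x ^- 2) - x^-1).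
  move=> x1; have x0 : 0 < x by lra.
  have dln := is_derive1_ln x0.
  have dV : is_derive x 1 (fun x : R => x^-1) (- x ^- 2).
    apply: (is_derive_eq (@is_deriveV R id x 1 1 _ _)); first by rewrite gt_eqF.
    by rewrite /GRing.scale /= mulr1.
  by apply: is_derive_eq; rewrite opprK.
have h1 : h 1 = 0 by rewrite /h /= !fctE /= ln1 invr1 subrr scaler0 subr0.
have hz : h z = (z - z^-1) / 2 - ln z by rewrite /h !fctE /= mulrC.
rewrite -subr_ge0 -hz -h1.
apply: (ge0_derive_le z1 dh) => x x1.
have -> : 2^-1 * (1 + x ^- 2) - x^-1 = 2^-1 * (1 - x^-1) ^+ 2.
  by field; rewrite gt_eqF //; lra.
by rewrite mulr_ge0 // sqr_ge0.
Qed.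

Lemma ln_ge_frac {R : realType} (z : R) : 1 <= z -> 2 * (z - 1) / (z + 1) <= ln z.
Proof.
move=> z1; pose h : R -> R := ln (R := R) + 4 \*: (fun x : R => (x + 1)^-1) .
have dh (x : R) : 1 <= x -> is_derive x 1 h (x^-1 - 4 * (x + 1) ^- 2).
  move=> x1; have x0 : 0 < x by lra.
  have dln := is_derive1_ln x0.
  have dV : is_derive x 1 (fun x : R => (x + 1)^-1) (- (x + 1) ^- 2).
    apply: (is_derive_eq (@is_deriveV R (id + cst 1) x 1 1 _ _)).
    - by rewrite gt_eqF // !fctE; lra.
    - by apply: is_derive_eq; rewrite addr0.
    - by rewrite /GRing.scale /= mulr1.
  by apply: is_derive_eq; rewrite scalerN.
have h1 : h 1 = 2 by rewrite /h !fctE /= ln1 add0r /GRing.scale /=; field.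
have hz : h z = ln z + 4 / (z + 1) by rewrite /h !fctE.
have -> : 2 * (z - 1) / (z + 1) = 2 - 4 / (z + 1) by field; rewrite gt_eqF //; lra.
rewrite lerBlDr -hz -h1.
apply: (ge0_derive_le z1 dh) => x x1.
have -> : x^-1 - 4 * (x + 1) ^- 2 = x^-1 * ((x - 1) / (x + 1)) ^+ 2.
  by field; rewrite !gt_eqF //; lra.
by rewrite mulr_ge0 ?sqr_ge0 // invr_ge0; lra.
Qed.

Lemma ln_natM {R : realType} (a b : nat) : (0 < a)%N -> (0 < b)%N ->
  ln (a * b)%:R = ln a%:R + ln b%:R :> R.
Proof. by move=> a0 b0; rewrite natrM lnM ?posrE ?ltr0n. Qed.

(** [ln_ge_frac] and [ln_le_half] at [a / b]. The lower bound enters cross-multiplied so that [lra]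
    can check it on literals. *)
Lemma ln_nat_diff {R : realType} (c : R) (a b : nat) : (0 < b <= a)%N ->
  c * (a%:R + b%:R) <= 2 * (a%:R - b%:R) ->
  c <= ln a%:R - ln b%:R :> R /\
  ln a%:R - ln b%:R <= (a%:R / b%:R - b%:R / a%:R) / 2 :> R.
Proof.
move=> /andP[b0 ba] cab; have a0 : (0 < a)%N by apply: leq_trans ba.
have [a0R b0R] : (0 < a%:R :> R) /\ (0 < b%:R :> R) by rewrite !ltr0n.
rewrite -ln_div ?posrE //; set z := a%:R / b%:R.
have z1 : 1 <= z by rewrite ler_pdivlMr // mul1r ler_nat.
split; last by have := ln_le_half z1; rewrite invf_div.
apply: le_trans (ln_ge_frac z1).
have -> : 2 * (z - 1) / (z + 1) = 2 * (a%:R - b%:R) / (a%:R + b%:R).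
  by rewrite /z; field; rewrite !gt_eqF ?addr_gt0.
by rewrite ler_pdivlMr // addr_gt0.
Qed.

(* The bounds for [2], [3] and [5] come from the expansions of these primes as
   products of powers of [16/15], [25/24] and [81/80]. *)
Lemma ln_small_primes {R : realType} :
  [/\ 88 / 127 <= ln (2 : R) <= 43 / 62, 123 / 112 <= ln (3 : R) <= 144 / 131,
      37 / 23 <= ln (5 : R) <= 124 / 77 & 177 / 91 <= ln (7 : R) <= 257 / 132] /\
  (163 / 68 <= ln (11 : R) <= 12 / 5 /\ 64 / 25 <= ln (13 : R) <= 77 / 30).
Proof.
have e (a b : nat) := @ln_natM R a b.
have := @ln_nat_diff R (2 / 31) 16 15 isT ltac:(lra).
have := @ln_nat_diff R (2 / 49) 25 24 isT ltac:(lra).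
have := @ln_nat_diff R (2 / 161) 81 80 isT ltac:(lra).
(* The next three ratios bring in 7, 11 and 13, each against primes already bounded. *)
have := @ln_nat_diff R (2 / 99) 50 49 isT ltac:(lra).
have := @ln_nat_diff R (2 / 241) 121 120 isT ltac:(lra).
have := @ln_nat_diff R (2 / 337) 169 168 isT ltac:(lra).
have -> : ln 16 = 4 * ln 2 :> R by rewrite (e 2 8)// (e 2 4)// (e 2 2)//; ring.
have -> : ln 15 = ln 3 + ln 5 :> R by rewrite (e 3 5)//.
have -> : ln 25 = 2 * ln 5 :> R by rewrite (e 5 5)//; ring.
have -> : ln 24 = 3 * ln 2 + ln 3 :> R by rewrite (e 3 8)// (e 2 4)// (e 2 2)//; ring.
have -> : ln 81 = 4 * ln 3 :> R by rewrite (e 9 9)// (e 3 3)//; ring.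
have -> : ln 80 = 4 * ln 2 + ln 5 :> R by rewrite (e 5 16)// (e 2 8)// (e 2 4)// (e 2 2)//; ring.
have -> : ln 50 = ln 2 + 2 * ln 5 :> R by rewrite (e 2 25)// (e 5 5)//; ring.
have -> : ln 49 = 2 * ln 7 :> R by rewrite (e 7 7)//; ring.
have -> : ln 121 = 2 * ln 11 :> R by rewrite (e 11 11)//; ring.
have -> : ln 120 = 3 * ln 2 + ln 3 + ln 5 :> R.
  by rewrite (e 15 8)// (e 3 5)// (e 2 4)// (e 2 2)//; ring.
have -> : ln 169 = 2 * ln 13 :> R by rewrite (e 13 13)//; ring.
have -> : ln 168 = 3 * ln 2 + ln 3 + ln 7 :> R.
  by rewrite (e 21 8)// (e 3 7)// (e 2 4)// (e 2 2)//; ring.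
move=> [? ?] [? ?] [? ?] [? ?] [? ?] [? ?].
repeat split; apply/andP; split; lra.
Qed.

(** * Explicit Chebyshev bounds *)

Lemma mangoldt_prime_power {R : realType} (n r : nat) : primes n = [:: r] ->
  mangoldt n = ln r%:R :> R.
Proof. by rewrite /mangoldt => ->. Qed.

Lemma mangoldt_eq0 {R : realType} (n : nat) : size (primes n) != 1%N ->
  mangoldt n = 0 :> R.
Proof. by rewrite /mangoldt; case: (primes n) => [|r []]. Qed.

Lemma mangoldt_smallE {R : realType} (L := @mangoldt R) :
  (L 1%N = 0) * (L 2%N = ln 2) * (L 3%N = ln 3) * (L 4%N = ln 2) *
  (L 5%N = ln 5) * (L 6%N = 0) * (L 7%N = ln 7) * (L 8%N = ln 2) *
  (L 9%N = ln 3) * (L 10%N = 0) * (L 11%N = ln 11) * (L 12%N = 0) *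
  (L 13%N = ln 13) * (L 14%N = 0) * (L 15%N = 0) * (L 16%N = ln 2) *
  (L 27%N = ln 3) * (L 32%N = ln 2) * (L 64%N = ln 2) * (L 128%N = ln 2).
Proof.
by do !split; rewrite /L ?mangoldt_eq0 //; exact: mangoldt_prime_power.
Qed.

Lemma ln4E {R : realType} : ln 4 = 2 * ln 2 :> R.
Proof. by rewrite (@ln_natM R 2 2) //; ring. Qed.

Lemma chebyshev_psi_le {R : realType} (n : nat) : (0 < n)%N ->
  chebyshev_psi n <= n%:R * ln 4 - ln 4 :> R.
Proof.
elim/ltn_ind: n => n IHn n0.
have [n1|n1] := leqP n 1.
  have -> : n = 1%N by lia.
  by rewrite /chebyshev_psi big_nat1 mul1r subrr mangoldt_eq0.
(* Equality holds at [n = 1], and halving preserves the slack [ln 4]. *)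
by apply: chebyshev_psi_half => //; apply: IHn; lia.
Qed.

(* Halving propagates any slack, so the sharper bound only has to be checked on
   one dyadic interval. *)
Lemma chebyshev_psi_le_sharp {R : realType} (n : nat) : (8 <= n)%N ->
  chebyshev_psi n <= n%:R * ln 4 - 3 * ln 4 :> R.
Proof.
elim/ltn_ind: n => n IHn n8.
have [n16|n16] := ltnP n 16; last first.
  by apply: chebyshev_psi_half; [lia|apply: IHn; lia].
have psi0 : chebyshev_psi 0 = 0 :> R by rewrite /chebyshev_psi big_geq.
rewrite ln4E; have [[l2 l3 l5 l7] [l11 l13]] := @ln_small_primes R.
case/andP: l2 => ? ?; case/andP: l3 => _ ?; case/andP: l5 => _ ?.
case/andP: l7 => _ ?; case/andP: l11 => _ ?; case/andP: l13 => _ ?.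
have : n \in iota 8 8 by rewrite mem_iota n8.
rewrite !inE.
by move=> /or4P[|||/or4P[|||/orP[]]] /eqP->;
  rewrite !chebyshev_psiS psi0 !mangoldt_smallE; lra.
Qed.

(** * Explicit Mertens estimates over all integers *)

Definition mertens_sum {R : realType} (n : nat) : R :=
  \sum_(1 <= d < n.+1) mangoldt d / d%:R.

(** The induction step is [ln t <= t - 1] at [t = m / (m + 1)]; [ln_fact_ge] uses the same
    inequality at [t = (n + 2) / (n + 1)]. *)
Lemma ln_fact_le {R : realType} (n : nat) : (0 < n)%N ->
  ln n`!%:R <= (n%:R + 1) * ln n%:R - n%:R + 1 :> R.
Proof.
elim: n => [//|m IHm _]; case: (posnP m) => [->|m0].
  by rewrite factS fact0 ln1; lra.
have {IHm} := IHm m0; rewrite factS ln_natM ?fact_gt0 //.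
have m0R : (0 : R) < m%:R by rewrite ltr0n.
have : 1 <= (m%:R + 1) * (ln m.+1%:R - ln m%:R) :> R.
  rewrite -[X in X <= _]opprK -[X in _ * X]opprB mulrN lerN2.
  rewrite -ln_div ?posrE ?ltr0n //.
  have := @le_ln1Dx R (m%:R / m.+1%:R - 1).
  rewrite ltrBrDl subrr divr_gt0 ?ltr0n // => /(_ isT); rewrite addrC subrK => h.
  have -> : -1 = (m%:R + 1) * (m%:R / m.+1%:R - 1) :> R.
    by rewrite -[m.+1%:R]natr1; field; rewrite gt_eqF //; lra.
  by rewrite ler_pM2l //; lra.
move: (ln m.+1%:R) => y; rewrite -[m.+1%:R]natr1; lra.
Qed.

Lemma ln_fact_ge {R : realType} (n : nat) :
  n%:R * ln n.+1%:R - n%:R <= ln n`!%:R :> R.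
Proof.
elim: n => [|n IHn]; first by rewrite fact0 ln1; lra.
rewrite factS ln_natM ?fact_gt0 //.
have : n.+1%:R * (ln n.+2%:R - ln n.+1%:R) <= 1 :> R.
  rewrite -ln_div ?posrE ?ltr0n //.
  have := @le_ln1Dx R (n.+2%:R / n.+1%:R - 1).
  rewrite ltrBrDl subrr divr_gt0 ?ltr0n // => /(_ isT); rewrite addrC subrK => h.
  rewrite [leRHS](_ : _ = n.+1%:R * (n.+2%:R / n.+1%:R - 1) :> R).
    by rewrite ler_pM2l // ltr0n.
  by rewrite -[n.+2%:R]natr1; field; have := ler0n R n; rewrite gt_eqF //; lra.
move: IHn; move: (ln n.+1%:R) (ln n.+2%:R) => y z; rewrite -[n.+1%:R]natr1; lra.
Qed.

(** Since [(n + 1) / d <= n %/ d + 1], Legendre's formula bounds the left side by [ln n! + psi n].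
    The factor [n + 1] instead of [n] matches [ln_fact_le]. *)
Lemma mertens_sum_le_of_psi {R : realType} (c : R) (n : nat) : (0 < n)%N ->
  chebyshev_psi n <= n%:R * ln 4 - c ->
  (n%:R + 1) * mertens_sum n <=
  (n%:R + 1) * (ln n%:R + ln 4 - 1) + 2 - ln 4 - c.
Proof.
move=> n0 psin; have := ln_fact_le (R := R) n0.
have : (n%:R + 1) * mertens_sum n <= ln n`!%:R + chebyshev_psi n :> R.
  rewrite -(@sum_mangoldt_divn R n) // /chebyshev_psi /mertens_sum mulr_sumr -big_split /=.
  rewrite big_nat [leRHS]big_nat; apply: ler_sum => d /andP[d0 _].
  have d0R : (0 : R) < d%:R by rewrite ltr0n.
  rewrite mulrCA -[X in _ <= _ + X]mulr1 -mulrDr ler_wpM2l ?mangoldt_ge0 //.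
  rewrite ler_pdivrMr // !natr1 -natrM ler_nat; exact: ltn_ceil.
lra.
Qed.

Lemma mertens_sum_le {R : realType} (n : nat) : (0 < n)%N ->
  mertens_sum n <= ln n%:R + ln 4 - 1 :> R.
Proof.
move=> n0; have := mertens_sum_le_of_psi n0 (chebyshev_psi_le n0 (R := R)).
have [[/andP[? ?] _ _ _] _] := @ln_small_primes R.
have n1 : (0 : R) < n%:R + 1 by rewrite natr1 ltr0n.
move=> h; rewrite -(ler_pM2l n1); apply: le_trans h _.
rewrite ln4E; lra.
Qed.

Lemma mertens_sum_le_sharp {R : realType} (n : nat) : (8 <= n)%N ->
  (n%:R + 1) * mertens_sum n <=
  (n%:R + 1) * (ln n%:R + ln 4 - 1) + 2 - 4 * ln 4 :> R.
Proof.
move=> n8; have n0 : (0 < n)%N by lia.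
have := mertens_sum_le_of_psi n0 (chebyshev_psi_le_sharp n8 (R := R)); lra.
Qed.

Lemma mertens_sum_ge {R : realType} (n : nat) : (0 < n)%N ->
  ln n.+1%:R - 1 <= mertens_sum n :> R.
Proof.
move=> n0; have n0R : (0 : R) < n%:R by rewrite ltr0n.
rewrite -(ler_pM2l n0R); have := @ln_fact_ge R n.
suff : ln n`!%:R <= n%:R * mertens_sum n :> R by lra.
rewrite -(@sum_mangoldt_divn R n) // /mertens_sum mulr_sumr.
rewrite big_nat [leRHS]big_nat; apply: ler_sum => d /andP[d0 _].
have d0R : (0 : R) < d%:R by rewrite ltr0n.
(* Here the opposite rounding is used: [n %/ d <= n / d]. *)
rewrite mulrCA ler_wpM2l ?mangoldt_ge0 // ler_pdivlMr // -natrM ler_nat.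
exact: leq_divM.
Qed.

(** * Rough numbers and the flow argument for primitive sets *)

Definition rough (p k : nat) : bool := (0 < k)%N && all (leq p) (primes k).

Lemma rough_dvd (p d k : nat) : (d %| k)%N -> rough p k -> rough p d.
Proof.
move=> dk /andP[k0 /allP kp]; rewrite /rough (dvdn_gt0 k0 dk) /=.
apply/allP => r; rewrite mem_primes => /and3P[r_pr _ rd]; apply: kp.
by rewrite mem_primes r_pr k0 (dvdn_trans rd).
Qed.

(** The equation at [k] reads only values above [k], so it is solved one index at a time from [N]
    downwards. This constructs the flow below. *)
Lemma downward_rec {T : Type} (t0 : T) (N : nat) (Phi : (nat -> T) -> nat -> T) :
  (forall e1 e2 k, (forall j, (k < j)%N -> e1 j = e2 j) -> Phi e1 k = Phi e2 k) ->
  exists e, forall k, e k = if (N < k)%N then t0 else Phi e k.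
Proof.
move=> ext.
suff /(_ N.+1)[e eP] : forall m, exists e, forall k, (N < k + m)%N ->
    e k = if (N < k)%N then t0 else Phi e k.
  by exists e => k; apply: eP; lia.
elim=> [|m [e eP]]; first by exists (fun=> t0) => k; rewrite addn0 => ->.
have [Nm|mN] := ltnP N m; first by exists e => k _; apply: eP; lia.
pose e' k := if k == (N - m)%N then Phi e k else e k.
have e'E k : (N - m < k)%N -> e' k = e k by rewrite /e'; case: eqVneq => // ->; rewrite ltnn.
exists e' => k Nk; rewrite {1}/e'; case: eqVneq => [kE|kNm].
  rewrite ltnNge kE leq_subr /=; apply: ext => j jk; rewrite e'E // -kE //.
have k_gt : (N - m < k)%N by lia.
rewrite eP; last lia.
by case: ifP => // _; apply: ext => j kj; rewrite e'E //; lia.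
Qed.

Lemma downward_ind (N : nat) (P : nat -> Prop) :
  (forall k, (N < k)%N -> P k) ->
  (forall k, (k <= N)%N -> (forall j, (k < j)%N -> P j) -> P k) -> forall k, P k.
Proof.
move=> P0 PS k; have [m km] : exists m, (N - k < m)%N by exists (N - k).+1.
elim: m k km => // m IHm k km; have [Nk|kN] := ltnP N k; first exact: P0.
apply: PS => // j kj; have [Nj|jN] := ltnP N j; first exact: P0.
by apply: IHm; lia.
Qed.

(* Mass [F b] is released at each [b] in [B] and flows down the divisibility
   order, a fraction [mangoldt q / ln k] of the mass at [k] moving to [k / q].
   The mass [e k] passing through [k] never exceeds [F k], and since [B] is
   primitive no released mass is absorbed by another element of [B], so that all
   of it arrives at [1]. *)
Lemma primitive_sum_le {R : realType} (p N : nat) (B : pred nat) (F : nat -> R) :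
  (0 < N)%N -> (forall k, 0 <= F k) ->
  (forall k, rough p k -> \sum_(1 <= q < N.+1 | rough p q)
     F (k * q)%N * (mangoldt q / ln (k * q)%:R) <= F k) ->
  (forall b, B b -> (1 < b)%N && rough p b) ->
  (forall a b, B a -> B b -> (a %| b)%N -> a = b) ->
  \sum_(1 <= b < N.+1 | B b) F b <= F 1%N.
Proof.
move=> N0 F0 Fsub Brough Bprim.
pose w (k q : nat) : R := mangoldt q / ln (k * q)%:R.
have w0 k q : 0 <= w k q by rewrite divr_ge0 ?mangoldt_ge0 ?lnn_ge0.
(* The factor [q = 1] would make the recursion at [k] read its own value; its weight is zero. *)
have w1 k : w k 1%N = 0 by rewrite /w mangoldt_eq0 // mul0r.
pose inflow (e : nat -> R) k := \sum_(1 <= q < N.+1) e (k * q)%N * w k q.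
(* On [B] the mass is declared to be [F k], whatever flows in; primitivity will show that nothing
   does. *)
pose Phi e k := if ~~ rough p k then 0 else if B k then F k else inflow e k.
have PhiP e1 e2 k : (forall j, (k < j)%N -> e1 j = e2 j) -> Phi e1 k = Phi e2 k.
  move=> e12; rewrite /Phi; case: ifP => // /negbFE/andP[k0 _]; case: ifP => // _.
  apply: eq_big_nat => q /andP[q0 _]; have [q1|q1] := leqP q 1.
    by rewrite (_ : q = 1%N) ?w1 ?mulr0 //; lia.
  by rewrite e12 // -{1}(muln1 k) ltn_mul2l k0.
have [e eE] := downward_rec 0 N PhiP.
have e_rough k : ~~ rough p k -> e k = 0.
  by move=> nr; rewrite eE /Phi nr; case: ifP.
(* Downward induction: outside [B] the mass is an inflow, which superharmonicity bounds by [F k]. *)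
have e_le : forall k, e k <= F k.
  apply: (@downward_ind N) => [k Nk|k kN IHk]; first by rewrite eE Nk.
  rewrite eE ltnNge kN /= /Phi; case: ifP => [_ //|/negbFE kr]; case: ifP => // _.
  apply: le_trans (Fsub k kr); rewrite [leRHS]big_mkcond /= /inflow.
  apply: ler_sum_nat => q /andP[q0 _]; have k0 : (0 < k)%N by case/andP: kr.
  case: ifP => [qr|qnr]; last first.
    rewrite e_rough ?mul0r //; apply: contraFN qnr; exact/rough_dvd/dvdn_mull.
  have [q1|q1] := leqP q 1.
    by rewrite (_ : q = 1%N) -/(w _ _) ?w1 ?mulr0 //; lia.
  by rewrite ler_wpM2r // IHk // -{1}(muln1 k) ltn_mul2l k0.
(* Mass is present only at divisors of elements of [B]. *)
have e_supp : forall k, (forall b, B b -> ~~ (k %| b)%N) -> e k = 0.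
  apply: (@downward_ind N) => [k Nk _|k kN IHk Bk]; first by rewrite eE Nk.
  rewrite eE ltnNge kN /= /Phi; case: ifP => // /negbFE kr.
  case: ifP => [/Bk|_]; first by rewrite dvdnn.
  apply: big1_seq => q /=; rewrite mem_index_iota => /andP[q0 _].
  have [q1|q1] := leqP q 1; first by rewrite (_ : q = 1%N) ?w1 ?mulr0 //; lia.
  rewrite IHk ?mul0r // => [|b Bb].
    by rewrite -{1}(muln1 k) ltn_mul2l q1; case/andP: kr => ->.
  by apply: contra (Bk b Bb); apply/dvdn_trans/dvdn_mulr.
have inflowE k : (0 < k <= N)%N -> inflow e k = e k - (if B k then F k else 0).
  move=> /andP[k0 kN]; rewrite [in RHS]eE ltnNge kN /= /Phi; case: ifP => [knr|kr].
    have -> : B k = false by apply: contraNF knr => /Brough/andP[].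
    rewrite subr0; apply: big1_seq => q _; rewrite e_rough ?mul0r //.
    by apply: contra knr; apply/rough_dvd/dvdn_mulr.
  case: ifP => Bk; last by rewrite subr0.
  (* Mass arriving at [k] in [B] from [k * q], [q > 1], would come from some [b] in [B] divisible by
     [k * q]. Then [k] divides [b], so [b = k], which is absurd. *)
  rewrite subrr; apply: big1_seq => q /=; rewrite mem_index_iota => /andP[q0 _].
  have [q1|q1] := leqP q 1; first by rewrite (_ : q = 1%N) ?w1 ?mulr0 //; lia.
  rewrite e_supp ?mul0r // => b Bb; apply/negP => kqb.
  have kb := Bprim _ _ Bk Bb (dvdn_trans (dvdn_mulr q (dvdnn k)) kqb).
  rewrite -kb in kqb; have := dvdn_leq k0 kqb.
  by rewrite leqNgt -{1}(muln1 k) ltn_mul2l k0 q1.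
(* Every [k > 1] sends out its whole mass, as the weights [mangoldt q / ln k] over [q %| k] add up
   to 1. Only the mass at 1 stays. *)
have total_inflow : \sum_(1 <= j < N.+1) inflow e j = \sum_(2 <= k < N.+1) e k.
  pose t k q j : R := if k == (j * q)%N then e k * (mangoldt q / ln k%:R) else 0.
  transitivity (\sum_(1 <= j < N.+1) \sum_(1 <= q < N.+1) \sum_(1 <= k < N.+1) t k q j).
    apply: eq_big_nat => j /andP[j0 _]; apply: eq_big_nat => q /andP[q0 _].
    rewrite -big_mkcond big_nat1_eq /w; case: ifP => // /negbT.
    by rewrite muln_gt0 j0 q0 /= ltnS -ltnNge eE => ->; rewrite mul0r.
  rewrite exchange_big /=; under eq_bigr do rewrite exchange_big /=.
  rewrite exchange_big /= big_ltn // [X in X + _](_ : _ = 0) ?add0r; last first.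
    apply: big1 => q _; apply: big1 => j _; rewrite /t; case: ifP => // /eqP/esym/eqP.
    by rewrite muln_eq1 => /andP[_ /eqP->]; rewrite mangoldt_eq0 // mul0r mulr0.
  apply: eq_big_nat => k /andP[k2 kN]; have k0 : (0 < k)%N by apply: ltnW.
  transitivity (\sum_(1 <= q < N.+1 | (q %| k)%N) e k / ln k%:R * mangoldt q); last first.
    rewrite -mulr_sumr sum_mangoldt_dvd ?k0 // mulfVK // gt_eqF // ln_gt0 // ltr1n //.
  rewrite [RHS]big_mkcond; apply: eq_big_nat => q /andP[q0 _].
  case: ifP => [qk|qnk]; last first.
    by apply: big1 => j _; rewrite /t; case: eqP qnk => // ->; rewrite dvdn_mull.
  rewrite (eq_bigr (fun j => if j == (k %/ q)%N then e k * (mangoldt q / ln k%:R) else 0)).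
    rewrite -big_mkcond big_nat1_eq divn_gt0 // (dvdn_leq k0 qk) /=.
    by rewrite (leq_ltn_trans (leq_div _ _) kN) mulrAC mulrA.
  by move=> j _; rewrite /t eqn_div // eq_sym.
have : \sum_(1 <= j < N.+1) inflow e j =
       \sum_(1 <= j < N.+1) e j - \sum_(1 <= b < N.+1 | B b) F b.
  by rewrite [X in _ - X]big_mkcond -sumrB; apply: eq_big_nat => j ?; apply: inflowE.
rewrite total_inflow [X in _ = X - _]big_ltn // => h.
have -> : \sum_(1 <= b < N.+1 | B b) F b = e 1%N by lra.
exact: e_le.
Qed.

(** * Partial summation against the kernel [1 / (x (x + al))] *)

Lemma abel_sum_le {R : realType} (a b phi Psi : nat -> R) (m n : nat) :
  (m <= n)%N ->
  (forall k, (m <= k)%N -> \sum_(m <= d < k.+1) a d <= b k) ->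
  (forall k, 0 <= phi k) -> (forall k, 0 <= Psi k) ->
  (forall k, (m <= k)%N -> phi k.+1 <= phi k) ->
  (forall k, (m <= k)%N -> (b k.+1 - b k) * phi k.+1 <= Psi k - Psi k.+1) ->
  \sum_(m <= d < n.+1) a d * phi d <= b m * phi m + Psi m.
Proof.
move=> mn ab phi0 Psi0 phi_decr step.
(* [Psi] plays the tail integral of [phi] against [b]. The induction carries the term by which the
   partial sum of [a] falls short of [b]; it only loses as [phi] decreases. *)
suff : \sum_(m <= d < n.+1) a d * phi d +
    (b n - \sum_(m <= d < n.+1) a d) * phi n <= b m * phi m + Psi m - Psi n.
  have : 0 <= (b n - \sum_(m <= d < n.+1) a d) * phi n.
    by rewrite mulr_ge0 // subr_ge0 ab.
  have := Psi0 n; lra.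
elim: n mn => [|n IHn].
  by rewrite leqn0 => /eqP ->; rewrite !big_nat1; lra.
rewrite leq_eqVlt => /orP[/eqP <-|mn]; first by rewrite !big_nat1; lra.
rewrite !(@big_nat_recr _ _ _ n.+1) ?(ltnW mn) //=.
have := IHn mn; have := step n mn.
have : 0 <= (b n - \sum_(m <= d < n.+1) a d) * (phi n - phi n.+1).
  by rewrite mulr_ge0 // subr_ge0 ?ab ?phi_decr.
nra.
Qed.

(** For [n > 1], at [x = ln n] and [al = 2 c], this is [g n / ln n] for the chosen weight [g]. *)
Definition inv_quad {R : realType} (al x : R) : R := (x * (x + al))^-1.

(** For positive [al] and [x], the integral of [inv_quad al] from [x] to infinity. *)
Definition inv_quad_primitive {R : realType} (al x : R) : R :=
  al^-1 * ln ((x + al) / x).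

Lemma inv_quad_primitive_step {R : realType} (al x y : R) : 0 < al -> 0 < x -> x <= y ->
  (y - x) * inv_quad al y <= inv_quad_primitive al x - inv_quad_primitive al y.
Proof.
move=> al0 x0 xy; have y0 : 0 < y by apply: lt_le_trans xy.
have [xa0 ya0] : 0 < x + al /\ 0 < y + al by split; lra.
rewrite /inv_quad_primitive -mulrBr -ln_div ?posrE ?divr_gt0 //.
set z := (x + al) / x / _.
have z0 : 0 < z by rewrite !divr_gt0.
have := @le_ln1Dx R (z^-1 - 1); rewrite ltrBrDl subrr invr_gt0 z0 => /(_ isT).
rewrite addrC subrK lnV ?posrE // => lnz.
have : al^-1 * (1 - z^-1) <= al^-1 * ln z by rewrite ler_pM2l ?invr_gt0 //; lra.
apply: le_trans.
have -> : al^-1 * (1 - z^-1) = (y - x) / ((x + al) * y).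
  by rewrite /z; field; rewrite !gt_eqF.
rewrite ler_wpM2l ?subr_ge0 // lef_pV2 ?posrE ?mulr_gt0 //.
by rewrite mulrC ler_pM2l // lerD2r.
Qed.

Lemma inv_quad_primitive_le {R : realType} (al x : R) : 0 < al -> 0 < x ->
  inv_quad_primitive al x <= (2 * x + al) / 2 * inv_quad al x.
Proof.
move=> al0 x0; have xa0 : 0 < x + al by lra.
have z1 : 1 <= (x + al) / x by rewrite ler_pdivlMr //; lra.
rewrite /inv_quad_primitive; have := ln_le_half z1.
rewrite -(ler_pM2l (_ : 0 < al^-1)) ?invr_gt0 // => /le_trans; apply.
rewrite le_eqVlt; apply/orP; left; apply/eqP.
by rewrite /inv_quad; field; rewrite !gt_eqF.
Qed.

Lemma inv_quad_sum_le {R : realType} (a : nat -> R) (K al c : R) (m n : nat) :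
  (1 < m)%N -> (m <= n)%N -> 0 <= K -> 0 < al ->
  (forall k, (m <= k)%N -> \sum_(m <= d < k.+1) a d <= ln k%:R - c) ->
  \sum_(m <= d < n.+1) a d * inv_quad al (K + ln d%:R) <=
  (2 * (ln m%:R - c) + 2 * (K + ln m%:R) + al) / 2 * inv_quad al (K + ln m%:R).
Proof.
move=> m1 mn K0 al0 ac.
pose u (k : nat) := K + ln k%:R.
have u0 k : 0 <= u k by rewrite addr_ge0 ?lnn_ge0.
have ugt0 k : (m <= k)%N -> 0 < u k.
  by move=> mk; rewrite ltr_wpDl // ln_gt0 // ltr1n (leq_trans m1).
have uS k : (m <= k)%N -> u k <= u k.+1.
  by move=> mk; rewrite lerD2l ler_ln ?posrE ?ltr0n ?ler_nat //; lia.
have phi0 k : 0 <= inv_quad al (u k).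
  by have := u0 k; rewrite /inv_quad invr_ge0 => ?; rewrite mulr_ge0 //; lra.
have Psi0 k : 0 <= inv_quad_primitive al (u k).
  rewrite /inv_quad_primitive mulr_ge0 ?invr_ge0 ?(ltW al0) //.
  (* For [k <= 1] and [K = 0] the argument is 0, and the conventions [0^-1 = 0] and [ln 0 = 0]
     apply. *)
  have := u0 k; rewrite le_eqVlt => /orP[/eqP <-|uk]; first by rewrite invr0 mulr0 ln0.
  by apply: ln_ge0; rewrite ler_pdivlMr //; lra.
have := @abel_sum_le R a (fun k => ln k%:R - c) (fun k => inv_quad al (u k))
  (fun k => inv_quad_primitive al (u k)) m n mn ac phi0 Psi0.
move=> /(_ _ _)/le_trans; apply.
- move=> k mk; have := uS k mk; have := ugt0 k mk => ? ?.
  by rewrite /inv_quad lef_pV2 ?posrE ?mulr_gt0 ?ler_pM //; lra.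
- move=> k mk; have := inv_quad_primitive_step al0 (ugt0 k mk) (uS k mk).
  by rewrite /u; lra.
have := inv_quad_primitive_le al0 (ugt0 m (leqnn m)); rewrite -/(u m); lra.
Qed.

(** With [al = 2 c] the constant cancels in the numerator of [inv_quad_sum_le], leaving
    [K + 2 ln m]. After cross-multiplication the claim is [2 c <= ln m], times [ln m]. *)
Lemma inv_quad_sum_le_inv {R : realType} (a : nat -> R) (K c : R) (m n : nat) :
  (1 < m)%N -> (m <= n)%N -> 0 <= K -> 0 < c -> 2 * c <= ln m%:R ->
  (forall k, (m <= k)%N -> \sum_(m <= d < k.+1) a d <= ln k%:R - c) ->
  \sum_(m <= d < n.+1) a d * inv_quad (2 * c) (K + ln d%:R) <= (K + 2 * c)^-1.
Proof.
move=> m1 mn K0 c0 cm ac; have al0 : 0 < 2 * c by lra.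
apply: le_trans (inv_quad_sum_le m1 mn K0 al0 ac) _; rewrite /inv_quad.
rewrite ler_pdivrMr; last by rewrite mulr_gt0 //; lra.
rewrite [leRHS]mulrC ler_pdivlMr; last lra.
nra.
Qed.

(** * Mertens estimates over rough numbers *)

Definition rough_mertens_sum {R : realType} (p n : nat) : R :=
  \sum_(1 <= d < n.+1 | rough p d) mangoldt d / d%:R.

Lemma rough_mertens_sum_le {R : realType} (p n : nat) (s : seq nat) :
  uniq s -> all (fun d => (1 < d)%N && ~~ rough p d) s -> all (leq^~ n) s ->
  rough_mertens_sum p n <= mertens_sum n - \sum_(d <- s) mangoldt d / d%:R :> R.
Proof.
move=> s_uniq /allP s_rough /allP s_le; rewrite lerBrDr.
have t0 d : 0 <= mangoldt d / d%:R :> R by rewrite divr_ge0 ?mangoldt_ge0.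
have -> : \sum_(d <- s) mangoldt d / d%:R =
    \sum_(1 <= d < n.+1 | d \in s) mangoldt d / d%:R :> R.
  rewrite -[RHS]big_filter; apply: perm_big; apply: uniq_perm; rewrite ?filter_uniq ?iota_uniq //.
  move=> d; rewrite mem_filter mem_index_iota; case ds: (d \in s) => //=.
  by have := s_rough d ds; have := s_le d ds; lia.
rewrite /mertens_sum [leRHS](bigID (rough p)) /= lerD2l.
rewrite big_mkcond [leRHS]big_mkcond; apply: ler_sum => d _.
case: ifP => [/s_rough/andP[_ ->] //|_]; case: ifP => // _; exact: t0.
Qed.

Lemma not_rough (p d : nat) : (1 < d < p)%N -> ~~ rough p d.
Proof.
move=> /andP[d1 dp]; apply/negP => /andP[_ /allP/(_ (pdiv d))].
rewrite mem_primes pdiv_prime // pdiv_dvd (ltnW d1) => /(_ isT).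
by rewrite leqNgt (leq_ltn_trans (pdiv_leq _)) // ltnW.
Qed.

Lemma mertens_sumS {R : realType} (n : nat) :
  mertens_sum n.+1 = mertens_sum n + mangoldt n.+1 / n.+1%:R :> R.
Proof. by rewrite /mertens_sum big_nat_recr. Qed.

(** Freezing the gain at a fixed [m > n] removes the dependence on [n], so that [lra] can compare
    constants. *)
Lemma mertens_sum_le_upto {R : realType} (n m : nat) : (8 <= n < m)%N ->
  mertens_sum n <= ln n%:R + ln 4 - 1 - (4 * ln 4 - 2) / m%:R :> R.
Proof.
move=> /andP[n8 nm]; have n0 : (0 : R) < n.+1%:R by rewrite ltr0n.
have := mertens_sum_le_sharp n8 (R := R); rewrite natr1 => h.
have : mertens_sum n <= ln n%:R + ln 4 - 1 - (4 * ln 4 - 2) / n.+1%:R :> R.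
  rewrite -(ler_pM2l n0); apply: le_trans h _; rewrite le_eqVlt; apply/orP; left.
  by apply/eqP; field; have := ler0n R n => ?; rewrite gt_eqF //; lra.
move/le_trans; apply; rewrite lerD2l lerN2.
have [[/andP[? _] _ _ _] _] := @ln_small_primes R.
by rewrite ler_wpM2l ?lef_pV2 ?posrE ?ltr0n ?ler_nat //; [rewrite ln4E; lra|lia].
Qed.

Lemma mertens_sum_smallE {R : realType} (M := @mertens_sum R) :
  (M 3%N = ln 2 / 2 + ln 3 / 3) * (M 4%N = M 3%N + ln 2 / 4) *
  (M 5%N = M 4%N + ln 5 / 5) * (M 6%N = M 5%N) * (M 7%N = M 6%N + ln 7 / 7) *
  (M 8%N = M 7%N + ln 2 / 8).
Proof.
have M0 : M 0%N = 0 by rewrite /M /mertens_sum big_geq.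
by do !split; rewrite /M mertens_sumS mangoldt_smallE ?mul0r ?addr0 //
  !mertens_sumS !mangoldt_smallE -/(M 0%N) M0 mul0r !add0r.
Qed.

Lemma rough_mertens_sum3_le {R : realType} (n : nat) : (3 <= n)%N ->
  rough_mertens_sum 3 n <= ln n%:R - 29 / 100 :> R.
Proof.
move=> n3; have [[/andP[? ?] l3 l5 l7] _] := @ln_small_primes R.
have ln4 := @ln4E R.
have Mle := @mertens_sum_le_upto R n.
have S := @rough_mertens_sum_le R 3 n.
have [n8|n8] := ltnP n 8.
  have ln6 : ln 6 = ln 2 + ln 3 :> R by exact: (@ln_natM R 2 3).
  have := S [:: 2%N] isT isT; rewrite big_seq1 mangoldt_smallE /= (ltnW n3) => /(_ isT).
  case/andP: l3 => ? ?; case/andP: l5 => ? ?; case/andP: l7 => ? ?.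
  have : n \in iota 3 5 by rewrite mem_iota n3.
  rewrite !inE => /or4P[|||/orP[]] /eqP->;
    rewrite ?ln4 ?ln6 !mertens_sum_smallE; lra.
(* Removing all powers of 2 would give the constant [1 - ln 2], about 0.307; 0.29 leaves room for
   stopping early. For smaller [n] fewer powers are available, and the gain of [mertens_sum_le_upto]
   compensates. *)
have [n32|n32] := ltnP n 32.
  have := S [:: 2; 4; 8]%N isT isT; rewrite !big_cons big_nil !mangoldt_smallE /=.
  rewrite (leq_trans _ n8) // (leq_trans _ n8) // n8 => /(_ isT).
  have := Mle 32%N; rewrite n8 n32 => /(_ isT); lra.
have le_n k : (k <= 32)%N -> (k <= n)%N by move/leq_trans; apply.
have [n64|n64] := ltnP n 128.
  have := S [:: 2; 4; 8; 16; 32]%N isT isT.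
  rewrite !big_cons big_nil !mangoldt_smallE /= !le_n // => /(_ isT).
  have := Mle 128%N; rewrite n8 n64 => /(_ isT); lra.
have := S [:: 2; 4; 8; 16; 32; 64; 128]%N isT isT.
have {}le_n k : (k <= 128)%N -> (k <= n)%N by move/leq_trans; apply.
rewrite !big_cons big_nil !mangoldt_smallE /= !le_n // => /(_ isT).
have := @mertens_sum_le R n; rewrite (leq_trans _ n3) // => /(_ isT); lra.
Qed.

(** No [d] with [1 < d < p] is rough, so all of [mertens_sum p.-1] can be removed. *)
Lemma rough_mertens_sum_le_generic {R : realType} (p n : nat) : (1 < p <= n)%N ->
  rough_mertens_sum p n <= mertens_sum n - (ln p%:R - 1) :> R.
Proof.
move=> /andP[p1 pn].
have := @rough_mertens_sum_le R p n (index_iota 2 p) (iota_uniq _ _).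
have -> : all (fun d => (1 < d)%N && ~~ rough p d) (index_iota 2 p).
  apply/allP => d; rewrite mem_index_iota => dp; rewrite not_rough //.
  by case/andP: dp => ->.
have -> : all (leq^~ n) (index_iota 2 p).
  by apply/allP => d; rewrite mem_index_iota => /andP[_ dp]; lia.
move=> /(_ isT isT)/le_trans; apply; rewrite lerD2l lerN2.
have := @mertens_sum_ge R p.-1; rewrite prednK ?(ltnW p1) // => /(_ _)/le_trans.
apply; first lia.
by rewrite /mertens_sum prednK ?(ltnW p1) // big_ltn // mangoldt_smallE mul0r add0r.
Qed.

Lemma rough_mertens_sum_le_half_ln {R : realType} (p n : nat) :
  prime p -> (5 <= p <= n)%N ->
  rough_mertens_sum p n <= ln n%:R - ln p%:R / 2 :> R.
Proof.
move=> p_pr /andP[p5 pn]; have p0 : (0 < p)%N by apply: leq_trans p5.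
have n0 : (0 < n)%N by apply: leq_trans pn.
have [[l2 l3 l5 l7] [l11 l13]] := @ln_small_primes R.
have ln4 := @ln4E R.
have Mle_upto := @mertens_sum_le_upto R n; have Mle := @mertens_sum_le R n n0.
have S := @rough_mertens_sum_le R p n.
have lnpn : ln p%:R <= ln n%:R :> R by rewrite ler_ln ?posrE ?ltr0n ?ler_nat.
have [p16|p17] := leqP p 16; last first.
  have := @rough_mertens_sum_le_generic R p n; rewrite pn (leq_trans _ p5) // => /(_ isT).
  have ln16 : ln 16 = 2 * ln 4 :> R by rewrite (@ln_natM R 4 4) //; ring.
  have : ln 16 <= ln p%:R :> R by rewrite ler_ln ?posrE ?ltr0n // ler_nat ltnW.
  lra.
have [p8|p8] := ltnP p 8.
  have : p \in iota 5 3 by rewrite mem_iota p5.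
  rewrite !inE => /or3P[/eqP pE|/eqP pE|/eqP pE]; last 1 first.
  (* The case [p = 7] comes first. For [n < 9] the sums are evaluated exactly; from 9 on, 8 and 9
     can be removed too. *)
  - have [n9|n9] := ltnP n 9.
      have := S [:: 2; 3; 4; 5]%N isT; rewrite pE => /(_ isT).
      rewrite !big_cons big_nil !mangoldt_smallE /= !(leq_trans _ pn) ?pE // => /(_ isT).
      rewrite pE in lnpn pn.
      have : n \in iota 7 2 by rewrite mem_iota pn.
      rewrite !inE => /orP[] /eqP nE; rewrite nE in lnpn *;
        rewrite !mertens_sum_smallE; case/andP: l7 => ? ?; case/andP: l2 => ? ?; lra.
    have le_n k : (k <= 9)%N -> (k <= n)%N by move/leq_trans; apply.
    case/andP: l2 => ? ?; case/andP: l3 => ? ?; case/andP: l5 => ? ?; case/andP: l7 => ? ?.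
    have := S [:: 2; 3; 4; 5; 8; 9]%N isT; rewrite pE => /(_ isT).
    by rewrite !big_cons big_nil !mangoldt_smallE /= !le_n // => /(_ isT); lra.
  - case/andP: l2 => ? ?; case/andP: l3 => ? ?; case/andP: l5 => ? ?.
    case/andP: l7 => ? ?; have [n9|n9] := ltnP n 9.
      have := S [:: 2; 3; 4]%N isT; rewrite pE => /(_ isT).
      rewrite !big_cons big_nil !mangoldt_smallE /= !(leq_trans _ pn) ?pE // => /(_ isT).
      rewrite pE in lnpn pn.
      have : n \in iota 5 4 by rewrite mem_iota pn.
      rewrite !inE => /or4P[] /eqP nE; rewrite nE in lnpn *;
        rewrite !mertens_sum_smallE; lra.
    have [n32|n32] := ltnP n 32.
      have le_n k : (k <= 9)%N -> (k <= n)%N by move/leq_trans; apply.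
      have := S [:: 2; 3; 4; 8; 9]%N isT; rewrite pE => /(_ isT).
      rewrite !big_cons big_nil !mangoldt_smallE /= !le_n // => /(_ isT).
      have := Mle_upto 32%N; rewrite n32 (leq_trans _ n9) // => /(_ isT); lra.
    have le_n k : (k <= 32)%N -> (k <= n)%N by move/leq_trans; apply.
    have := S [:: 2; 3; 4; 8; 9; 16; 27; 32]%N isT; rewrite pE => /(_ isT).
    by rewrite !big_cons big_nil !mangoldt_smallE /= !le_n // => /(_ isT); lra.
  - by rewrite pE in p_pr.
have : p \in iota 8 9 by rewrite mem_iota p8.
(* As [n >= 11], all prime powers below 11 can be removed for both primes. *)
move=> p_in; have [pE|pE] : p = 11%N \/ p = 13%N.
  move: p_in p_pr; rewrite !inE.
  by do 8?[case/orP=> [/eqP->|]] => //; [left|right|move/eqP->].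
all: have le_n k : (k <= 11)%N -> (k <= n)%N by
  rewrite pE in pn => /leq_trans; apply; apply: leq_trans pn.
all: case/andP: l2 => ? ?; case/andP: l3 => ? ?; case/andP: l5 => ? ?.
all: case/andP: l7 => ? ?; case/andP: l11 => _ ?; case/andP: l13 => _ ?.
all: have := S [:: 2; 3; 4; 5; 7; 8; 9]%N isT; rewrite pE => /(_ isT).
all: by rewrite !big_cons big_nil !mangoldt_smallE /= !le_n // => /(_ isT); lra.
Qed.

(** * Superharmonicity *)

Lemma rough_mangoldt_eq0 {R : realType} (p d : nat) : (d < p)%N -> rough p d ->
  mangoldt d = 0 :> R.
Proof.
move=> dp dr; rewrite mangoldt_eq0 //; have [d1|d1] := ltnP 1 d.
  by move: (@not_rough p d); rewrite d1 dp dr => /(_ isT).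
by case: d d1 {dp dr} => [|[|]].
Qed.

Lemma sum_rough_from {R : realType} (p n : nat) (phi : nat -> R) :
  (0 < p <= n.+1)%N ->
  \sum_(1 <= d < n.+1 | rough p d) mangoldt d / d%:R * phi d =
  \sum_(p <= d < n.+1) (if rough p d then mangoldt d / d%:R else 0) * phi d.
Proof.
move=> /andP[p0 pn]; rewrite big_mkcond /= (@big_cat_nat _ _ _ p) //= big_nat big1 => [|d].
  by rewrite add0r; apply: eq_bigr => d _; case: ifP; rewrite ?mul0r.
move=> /andP[_ dp]; case: ifP => // dr.
by rewrite (rough_mangoldt_eq0 dp dr) !mul0r.
Qed.

Lemma rough_mertens_sum_from {R : realType} (p n : nat) : (0 < p <= n.+1)%N ->
  rough_mertens_sum p n =
  \sum_(p <= d < n.+1) (if rough p d then mangoldt d / d%:R else 0) :> R.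
Proof.
move=> pn; have := sum_rough_from (fun=> 1 : R) pn.
by under eq_bigr do rewrite mulr1; under [RHS]eq_bigr do rewrite mulr1.
Qed.

(** Superharmonicity at [k > 1] is the case [K = ln k], up to the factor [1 / k]. When [2 c = ln p],
    the case [K = 0] settles [k = 1]. *)
Lemma inv_quad_sum_rough_le {R : realType} (p N : nat) (K c : R) :
  (1 < p)%N -> 0 <= K -> 0 < c -> 2 * c <= ln p%:R ->
  (forall n, (p <= n)%N -> rough_mertens_sum p n <= ln n%:R - c) ->
  \sum_(1 <= q < N.+1 | rough p q)
    mangoldt q / q%:R * inv_quad (2 * c) (K + ln q%:R) <= (K + 2 * c)^-1.
Proof.
move=> p1 K0 c0 cp rough_le; have p0 := ltnW p1.
have [Np|pN] := ltnP N p.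
  rewrite big_nat_cond big1 ?invr_ge0 => [|q /andP[/andP[_ qN] qr]]; first lra.
  by rewrite (rough_mangoldt_eq0 (leq_ltn_trans _ Np) qr) ?mul0r.
rewrite sum_rough_from ?p0 ?(leqW pN) //.
apply: inv_quad_sum_le_inv => // k pk.
by rewrite -rough_mertens_sum_from ?p0 ?(leqW pk) // rough_le.
Qed.

Lemma inv_le_of_mul {R : realType} (x r : R) : 0 < x -> 1 <= r * x -> x^-1 <= r.
Proof. by move=> x0; rewrite -ler_pdivrMr // mul1r. Qed.

Lemma inv_quad_term_le {R : realType} (al x k r : R) :
  0 < al -> 0 < x -> 0 < k -> 1 <= r * (k * (x + al)) -> x / k * inv_quad al x <= r.
Proof.
move=> al0 x0 k0 h; have xa0 : 0 < x + al by lra.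
have -> : x / k * inv_quad al x = (k * (x + al))^-1.
  by rewrite /inv_quad; field; rewrite !gt_eqF.
by apply: inv_le_of_mul => //; rewrite mulr_gt0.
Qed.

(** The general bound at [K = 0] would only give [1 / 0.58], which is too large. The terms at 3, 5,
    7 and 9 are therefore estimated one by one, and partial summation starts at 10. *)
Lemma inv_quad_sum_rough3_le {R : realType} (N : nat) :
  \sum_(1 <= q < N.+1 | rough 3 q)
    mangoldt q / q%:R * inv_quad (2 * (29 / 100)) (ln q%:R) <= (ln 3)^-1 :> R.
Proof.
pose t q : R := (if rough 3 q then mangoldt q / q%:R else 0).
pose phi q : R := inv_quad (2 * (29 / 100)) (ln q%:R).
have t0 q : 0 <= t q by rewrite /t; case: ifP; rewrite ?divr_ge0 ?mangoldt_ge0.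
have phi0 q : 0 <= phi q.
  have l0 := @lnn_ge0 R q.
  by rewrite /phi /inv_quad invr_ge0 mulr_ge0 //; move: l0; lra.
wlog N10 : N / (10 <= N)%N => [wlogN|].
  have [|N10] := leqP 10 N; first exact: wlogN.
  apply: le_trans (wlogN 10%N isT); rewrite [leRHS]big_mkcond.
  rewrite [leRHS](@big_cat_nat _ _ _ N.+1) ?(leqW N10) //=.
  rewrite -big_mkcond lerDl sumr_ge0 // => q _.
  by have := t0 q; rewrite /t; case: ifP => // _ ?; rewrite mulr_ge0 ?phi0.
have N3 : (0 < 3 <= N.+1)%N by rewrite /= leqW // (leq_trans _ N10).
rewrite (sum_rough_from phi N3) (@big_cat_nat _ _ _ 10) ?(leqW N10) //=.
have [[/andP[? ?] /andP[l3 u3] /andP[l5 ?] /andP[l7 ?]] _] := @ln_small_primes R.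
have ln9 : ln 9 = 2 * ln 3 :> R by rewrite (@ln_natM R 3 3) //; ring.
have ln10 : ln 10 = ln 2 + ln 5 :> R by exact: (@ln_natM R 2 5).
have S9 : \sum_(3 <= d < 10) t d = ln 3 / 3 + ln 5 / 5 + ln 7 / 7 + ln 3 / 9 :> R.
  by rewrite /index_iota /= !big_cons big_nil /t /= !mangoldt_smallE; ring.
have head : \sum_(3 <= d < 10) t d * phi d <= 369 / 1000.
  have term := @inv_quad_term_le R (2 * (29 / 100)).
  have b3 : ln 3 / 3 * phi 3%N <= 199 / 1000 by apply: term; lra.
  have b5 : ln 5 / 5 * phi 5%N <= 92 / 1000 by apply: term; lra.
  have b7 : ln 7 / 7 * phi 7%N <= 57 / 1000 by apply: term; lra.
  (* [inv_quad_term_le] wants the kernel's argument [ln 9 = 2 ln 3] in the weight. *)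
  have b9 : ln 3 / 9 * phi 9%N <= 21 / 1000.
    rewrite (_ : ln 3 / 9 = 2 * ln 3 / 18); last by field.
    by rewrite /phi ln9; apply: term; lra.
  by rewrite /index_iota /= !big_cons big_nil /t /= !mangoldt_smallE; lra.
(* The sum over [3 <= d < 10] is subtracted from the Mertens bound. The two factors bound [2 ln 10]
   minus that sum, and the kernel at [ln 10]. *)
have tail : \sum_(10 <= d < N.+1) t d * phi d <= 353 / 100 * (151 / 1000).
  have al0 : (0 : R) < 2 * (29 / 100) by lra.
  have t_le k : (10 <= k)%N -> \sum_(10 <= d < k.+1) t d <=
      ln k%:R - (29 / 100 + \sum_(3 <= d < 10) t d).
    move=> k10; have := @rough_mertens_sum3_le R k.
    rewrite (leq_trans _ k10) // => /(_ isT).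
    have k3 : (0 < 3 <= k.+1)%N by rewrite /= leqW // (leq_trans _ k10).
    by rewrite rough_mertens_sum_from // -/t (@big_cat_nat _ _ _ 10) ?(leqW k10) //=; lra.
  have := @inv_quad_sum_le R t 0 _ _ 10 N isT N10 (lexx _) al0 t_le.
  under eq_bigr do rewrite add0r; rewrite !add0r => /le_trans; apply.
  rewrite S9 ln10; apply: ler_pM; rewrite ?invr_ge0; [lra| |lra|].
    by rewrite mulr_ge0; lra.
  have x0 : 0 < ln 2 + ln 5 :> R by lra.
  apply: inv_le_of_mul; first by rewrite mulr_gt0 //; lra.
  have : 2301 / 1000 * (2881 / 1000) <= (ln 2 + ln 5) * (ln 2 + ln 5 + 2 * (29 / 100)) :> R.
    by apply: ler_pM; lra.
  lra.
have : 909 / 1000 <= (ln 3)^-1 :> R.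
  by rewrite -[leLHS]invrK lef_pV2 ?posrE ?invr_gt0; [apply: le_trans u3 _|..]; lra.
move: head tail; rewrite -/t; lra.
Qed.

(** * Choice of the weights and conclusion *)

Lemma rough_primitive_sum_le {R : realType} (p N : nat) (B : pred nat) :
  prime p -> (2 < p)%N -> (forall b, B b -> rough p b) ->
  (forall a b, B a -> B b -> (a %| b)%N -> a = b) ->
  \sum_(1 <= b < N.+1 | B b) (b%:R * (ln p%:R + ln b%:R))^-1 <= (ln p%:R)^-1 :> R.
Proof.
move=> p_pr p2 Br Bprim; set l : R := ln p%:R.
have p1 := prime_gt1 p_pr.
have l0 : 0 < l by rewrite ln_gt0 // ltr1n.
have [N0|N0] := posnP N; first by rewrite N0 big_geq // invr_ge0 ltW.
(* If 1 lies in [B], primitivity forces [B] to be the singleton of 1, with equality when [N > 0]. *)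
have [B1|B1] := boolP (B 1%N).
  rewrite big_mkcond (eq_bigr (fun b => if b == 1%N then l^-1 else 0)) => [|b _].
    by rewrite -big_mkcond big_nat1_eq; case: ifP => // _; rewrite invr_ge0 ltW.
  case: eqVneq => [->|b1]; first by rewrite B1 ln1 addr0 mul1r.
  by case: ifP => // /(Bprim _ _ B1)/(_ (dvd1n b)) b1E; rewrite b1E eqxx in b1.
(* [2 c <= ln p] makes [F] dominate the summands, the Mertens bound gives superharmonicity at
   [k > 1], and the last condition is superharmonicity at 1. *)
suff [c [c0 cl c_rough c1]] : exists c : R, [/\ 0 < c, 2 * c <= l,
    forall n, (p <= n)%N -> rough_mertens_sum p n <= ln n%:R - c &
    \sum_(1 <= q < N.+1 | rough p q)
      mangoldt q / q%:R * inv_quad (2 * c) (ln q%:R) <= l^-1].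
  pose F (k : nat) : R := k%:R^-1 * (if k == 1%N then l^-1 else (ln k%:R + 2 * c)^-1).
  have F0 k : 0 <= F k.
    have := @lnn_ge0 R k => lk.
    by rewrite mulr_ge0 ?invr_ge0 //; case: ifP => _; rewrite invr_ge0; lra.
  have Fsub k : rough p k -> \sum_(1 <= q < N.+1 | rough p q)
      F (k * q)%N * (mangoldt q / ln (k * q)%:R) <= F k.
    move=> /andP[k0 _].
    have -> : \sum_(1 <= q < N.+1 | rough p q) F (k * q)%N * (mangoldt q / ln (k * q)%:R) =
        k%:R^-1 * \sum_(1 <= q < N.+1 | rough p q)
          mangoldt q / q%:R * inv_quad (2 * c) (ln k%:R + ln q%:R) :> R.
      rewrite mulr_sumr big_nat_cond [RHS]big_nat_cond.
      apply: eq_bigr => q /andP[/andP[q0 _] _].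
      have [q1|q1] := leqP q 1.
        by rewrite (_ : q = 1%N) ?mangoldt_smallE ?mul0r ?mulr0 ?mul0r ?mulr0 //; lia.
      rewrite /F ifF; last by rewrite muln_eq1; lia.
      rewrite ln_natM // natrM /inv_quad !invfM; ring.
    rewrite ler_wpM2l ?invr_ge0 //; case: ifP => [/eqP ->|k1].
      by rewrite ln1; under eq_bigr do rewrite add0r.
    by apply: inv_quad_sum_rough_le => //; exact: lnn_ge0.
  have Bgt1 b : B b -> (1 < b)%N && rough p b.
    move=> Bb; rewrite Br // andbT; have /andP[b0 _] := Br b Bb.
    by rewrite ltn_neqAle b0 andbT; apply: contraNneq B1 => ->.
  have := primitive_sum_le N0 F0 Fsub Bgt1 Bprim.
  rewrite {2}/F eqxx invr1 mul1r; apply: le_trans.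
  rewrite big_nat_cond [leRHS]big_nat_cond; apply: ler_sum => b /andP[_ Bb].
  have /andP[b1 _] := Bgt1 b Bb; have lb := @lnn_ge0 R b.
  rewrite /F gtn_eqF // invfM ler_wpM2l ?invr_ge0 //.
  by rewrite lef_pV2 ?posrE; lra.
have [p5|p5] := leqP 5 p.
  exists (l / 2); have l2 : 2 * (l / 2) = l by field.
  have c_rough n : (p <= n)%N -> rough_mertens_sum p n <= ln n%:R - l / 2.
    by move=> pn; rewrite rough_mertens_sum_le_half_ln // p5.
  split=> //; [lra|lra|].
  have := @inv_quad_sum_rough_le R p N 0 (l / 2) p1 (lexx _).
  by under eq_bigr do rewrite add0r; rewrite l2 add0r; apply => //; lra.
have p3 : p = 3%N by case: p p_pr p2 p5 {p1 l l0 Br} => [|[|[|[|[|]]]]].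
exists (29 / 100); rewrite /l p3.
have [[_ /andP[? _] _ _] _] := @ln_small_primes R.
split; [lra|lra|exact: rough_mertens_sum3_le|exact: inv_quad_sum_rough3_le].
Qed.

Lemma rough_of_pdiv_mul (p b : nat) : prime p -> (0 < b)%N -> pdiv (p * b) = p ->
  rough p b.
Proof.
move=> p_pr b0 pbE; rewrite /rough b0; apply/allP => r.
rewrite mem_primes => /and3P[r_pr _ rb]; rewrite -pbE.
by apply: pdiv_min_dvd; rewrite ?prime_gt1 // dvdn_mull.
Qed.

(** Reindexing by [b = i %/ p]; the range for [b] is generous, which is harmless as [F] is
    nonnegative. *)
Lemma sum_multiples_le {R : realType} (F : nat -> R) (P : pred nat) (p n : nat) :
  (0 < p)%N -> (forall i, 0 <= F i) -> (forall i, P i -> (0 < i)%N && (p %| i)%N) ->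
  \sum_(0 <= i < n | P i) F i <= \sum_(1 <= b < n.+1 | P (p * b)%N) F (p * b)%N.
Proof.
move=> p0 F0 Pp; pose t i b := if i == (p * b)%N then (if P i then F i else 0) else 0.
have -> : \sum_(0 <= i < n | P i) F i = \sum_(0 <= i < n) \sum_(1 <= b < n.+1) t i b.
  rewrite big_mkcond /=; apply: eq_big_nat => i /andP[_ i_n].
  case Pi: (P i); last by rewrite big1 // => b _; rewrite /t Pi if_same.
  have /andP[i0 pi] := Pp i Pi.
  rewrite (eq_bigr (fun b => if b == (i %/ p)%N then F i else 0)) => [|b _].
    rewrite -big_mkcond big_nat1_eq divn_gt0 // dvdn_leq //=.
    by rewrite ltnS (leq_trans (leq_div _ _)) // ltnW.
  by rewrite /t Pi eq_sym mulnC -eqn_div.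
rewrite exchange_big /= [leRHS]big_mkcond /=; apply: ler_sum => b _.
rewrite /t -big_mkcond big_nat1_eq /=; case: ifP => _ //; case: ifP => _ //; exact: F0.
Qed.

Theorem theorem1p3 (R : realType) (A : set nat) (p : nat) :
  subset_gt1 A -> primitive A -> prime p -> (2 < p)%N ->
  (f R (A_p A p) <= f R [set p] /\
   f R [set p] = ((p%:R * ln (p%:R : R))^-1)%:E)%E.
Proof.
move=> A1 Aprim p_pr p2; have p0 := prime_gt0 p_pr.
pose F (n : nat) : R := (n%:R * ln n%:R)^-1.
have F0 n : 0 <= F n by rewrite invr_ge0 mulr_ge0 ?lnn_ge0.
have fpE : f R [set p] = (F p)%:E by rewrite /f esum_set1 // lee_fin F0.
split=> //; rewrite fpE.
pose P n := `[< A_p A p n >].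
have -> : A_p A p = [set n | P n].
  by apply/seteqP; split=> n /=; rewrite /P asboolE.
have Pp n : P n -> (0 < n)%N && (p %| n)%N.
  move=> /asboolP[An pE]; have n1 := A1 n An.
  by rewrite -pE pdiv_dvd (ltnW n1).
rewrite /f -nneseries_esum => [|n _]; last by rewrite lee_fin F0.
(* The extended sum is the limit of its partial sums, so a uniform bound on these suffices. *)
apply: lime_le; first by apply: is_cvg_nneseries => n _ _; rewrite lee_fin F0.
apply: nearW => n; rewrite sumEFin lee_fin.
apply: le_trans (sum_multiples_le n p0 F0 Pp) _.
have PB b : P (p * b)%N -> rough p b.
  move=> Pb; have /andP[pb0 _] := Pp _ Pb; move/asboolP: Pb => [_ pE].
  by apply: rough_of_pdiv_mul => //; move: pb0; rewrite muln_gt0 => /andP[].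
have Pprim a b : P (p * a)%N -> P (p * b)%N -> (a %| b)%N -> a = b.
  move=> /asboolP[Aa _] /asboolP[Ab _] ab.
  have := Aprim _ _ Aa Ab; rewrite dvdn_pmul2l // ab eqn_pmul2l //.
  by case: eqVneq => // _ /(_ isT).
have := @rough_primitive_sum_le R p n _ p_pr p2 PB Pprim.
have pV0 : 0 < p%:R^-1 :> R by rewrite invr_gt0 ltr0n.
(* Writing [n = p * b] splits off the factor [1 / p] and turns [ln n] into [ln p + ln b]. *)
rewrite -(ler_pM2l pV0) /F invfM => /(le_trans _); apply.
rewrite mulr_sumr le_eqVlt; apply/orP; left; apply/eqP.
rewrite big_nat_cond [RHS]big_nat_cond; apply: eq_bigr => b /andP[/andP[b0 _] _].
by rewrite ln_natM // natrM !invfM mulrA.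
Qed.
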